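(* Every ultrafilter base for the computable sets uniformly computes a dominating function; in other words, $\mathrm{DomFcn}\le_s\mathcal{U}$.
   Context: For sets $A,B\subseteq\omega$, $A\subseteq^* B$ means $A\setminus B$ is finite; $\overline{R}=\omega\setminus R$. With $\langle\cdot,\cdot\rangle$ the usual computable Cantor pairing function on $\omega$, a set $X\subseteq\omega$ encodes the sequence $(X_n)_{n\in\omega}$ of its columns $X_n=\{u:\langle u,n\rangle\in X\}$. A set $F$ is an ultrafilter base (for the Boolean algebra of computable sets) if each $F_n$ is computable, $F_0=\omega$, for each $n$ we have $F_{n+1}\subseteq^* F_n$ and $F_n\setminus F_{n+1}$ is infinite, and for each computable set $R$ there is $n$ with $F_n\subseteq^* R$ or $F_n\subseteq^*\overline{R}$. $\mathcal{U}$ is the class of all such sets $F$. For $f,g\colon\omega\to\omega$, $g$ dominates $f$ if $g(n)\ge f(n)$ for all sufficiently large $n$. $\mathrm{DomFcn}$ is the class of functions $h\colon\omega\to\omega$ that dominate every computable function and satisfy $h(s)\ge s$ for all $s$. Medvedev reducibility between classes of functions on $\omega$ (sets are identified with characteristic functions): $\mathcal{C}\le_s\mathcal{D}$ if there is a Turing functional $\Theta$ such that $\Theta^g\in\mathcal{C}$ for each $g\in\mathcal{D}$. *)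

(* Defs.v *)
From Stdlib Require Import Arith Cantor Ensembles Finite_sets Image.
From Stdlib Require Import ClassicalEpsilon.

(** * Turing functionals

    Oracle programs are Kleene's schemes for partial recursive functions,
    in unary form: several arguments are packed with the Cantor pairing
    [to_nat (x, y) = y + (x + y)(x + y + 1)/2], and the two projections are
    basic functions.  [Oracle] is a query to the oracle. *)

Inductive code : Type :=
| Zero : code
| Succ : code
| Left : code
| Right : code
| Oracle : code
| Pair : code -> code -> code
| Comp : code -> code -> code
| Prec : code -> code -> code
| Mu : code -> code.

(** [eval g c x y]: program [c] with oracle [g] halts on [x] with output [y].

    - In [Prec a b], on input <z, n>, [w] lists the successive values
      w(0) = a(z) and w(i+1) = b(<z, <i, w(i)>>), and the output is w(n).
    - [Mu a] is unbounded search: on input [x], the least [y] with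
      a(<x, y>) = 0, where a(<x, m>) must halt for every m < y. *)
Fixpoint eval (g : nat -> nat) (c : code) (x y : nat) {struct c} : Prop :=
  match c with
  | Zero => y = 0
  | Succ => y = S x
  | Left => y = fst (of_nat x)
  | Right => y = snd (of_nat x)
  | Oracle => y = g x
  | Pair a b => exists u v, eval g a x u /\ eval g b x v /\ y = to_nat (u, v)
  | Comp a b => exists u, eval g b x u /\ eval g a u y
  | Prec a b =>
      let z := fst (of_nat x) in
      let n := snd (of_nat x) in
      exists w : nat -> nat,
        eval g a z (w 0) /\
        (forall i, i < n -> eval g b (to_nat (z, to_nat (i, w i))) (w (S i))) /\
        y = w n
  | Mu a =>
      eval g a (to_nat (x, y)) 0 /\
      (forall m, m < y -> exists v, v <> 0 /\ eval g a (to_nat (x, m)) v)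
  end.

Lemma eval_functional (g : nat -> nat) (c : code) (x y y' : nat) :
  eval g c x y -> eval g c x y' -> y = y'.
Proof.
revert x y y'; induction c as [ | | | | | a IHa b IHb | a IHa b IHb
  | a IHa b IHb | a IHa]; simpl; intros x y y'; try congruence.
- intros (u & v & Hu & Hv & ->) (u' & v' & Hu' & Hv' & ->).
  now rewrite (IHa _ _ _ Hu Hu'), (IHb _ _ _ Hv Hv').
- intros (u & Hu & Hy) (u' & Hu' & Hy').
  rewrite <- (IHb _ _ _ Hu Hu') in Hy'; eauto.
- intros (w & H0 & HS & ->) (w' & H0' & HS' & ->).
  assert (E : forall i, i <= snd (of_nat x) -> w i = w' i).
  { induction i as [|i IH]; intros Hi; [eauto|].
    specialize (HS i Hi); specialize (HS' i Hi).
    rewrite <- (IH (Nat.lt_le_incl _ _ Hi)) in HS'; eauto. }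
  now apply E.
- intros (H & Hlt) (H' & Hlt').
  destruct (Nat.lt_trichotomy y y') as [L | [E | L]]; trivial; exfalso.
  + destruct (Hlt' _ L) as (v & Hv & Ev); apply Hv; eauto.
  + destruct (Hlt _ L) as (v & Hv & Ev); apply Hv; eauto.
Qed.

Fixpoint oracle_free (c : code) : Prop :=
  match c with
  | Oracle => False
  | Zero | Succ | Left | Right => True
  | Pair a b | Comp a b | Prec a b => oracle_free a /\ oracle_free b
  | Mu a => oracle_free a
  end.

(** The program makes no queries, so the oracle supplied to [eval] is
    immaterial. *)
Definition computable (f : nat -> nat) : Prop :=
  exists c, oracle_free c /\ forall n, eval (fun _ => 0) c n (f n).

(** * Sets of natural numbers *)

Definition chi (X : Ensemble nat) (n : nat) : nat :=
  if excluded_middle_informative (In nat X n) then 1 else 0.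

Definition computable_set (X : Ensemble nat) : Prop := computable (chi X).

Definition almost_included (A B : Ensemble nat) : Prop :=
  Finite nat (Setminus nat A B).

Definition column (X : Ensemble nat) (n : nat) : Ensemble nat :=
  fun u => In nat X (to_nat (u, n)).

Definition ultrafilter_base (F : Ensemble nat) : Prop :=
  (forall n, computable_set (column F n)) /\
  Same_set nat (column F 0) (Full_set nat) /\
  (forall n, almost_included (column F (S n)) (column F n) /\
             ~ Finite nat (Setminus nat (column F n) (column F (S n)))) /\
  (forall R, computable_set R ->
     exists n, almost_included (column F n) R \/
               almost_included (column F n) (Complement nat R)).

(** * Classes of functions and Medvedev reducibility *)

(** The class of all ultrafilter bases, each identified with its
    characteristic function. *)
Definition U : Ensemble (nat -> nat) :=
  Im (Ensemble nat) (nat -> nat) ultrafilter_base chi.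

Definition dominates (g f : nat -> nat) : Prop :=
  exists N, forall n, N <= n -> f n <= g n.

Definition DomFcn : Ensemble (nat -> nat) :=
  fun h => (forall f, computable f -> dominates h f) /\
           (forall s, s <= h s).

(** The Turing functional is given by the program [c]; its value at [g]
    belongs to [C] when it is a total function [f] in [C]. *)
Definition medvedev_le (C D : Ensemble (nat -> nat)) : Prop :=
  exists c : code, forall g, In (nat -> nat) D g ->
    exists f, In (nat -> nat) C f /\ forall n, eval g c n (f n).

(* Main.v *)
From Stdlib Require Import Arith Lia Cantor List Bool Classical ClassicalEpsilon.
From Stdlib Require Import Ensembles Finite_sets Finite_sets_facts.
Require Import Defs.

(** The columns F_n of an ultrafilter base F are computable, but F knows no
    programs for them. It can however measure how complex they look: given a
    column F_n and a number s, it searches for a number k >= s and a time t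
    such that the program attached to k, run for time t, correctly computes
    F_n on an initial segment of the numbers that contains more than 2k elements
    of F_n. A true program for F_n exists and is attached to arbitrarily large k,
    and F_n is infinite, so the search always succeeds ([good_exists]). Each
    number k also carries a colour, and there is one search for every column n
    and colour i, restricted to the k of colour i. The value h(s) bounds the
    witnesses found by the searches for s and all (n, i) with code at most s
    ([exists_bound]).

    The function h dominates every computable f. From f one builds a
    computable set R by a coloring in steps: at step k, run the program
    attached to k for time f(0) + ... + f(k), and give the colour of k to the
    least element >= k within this bound that the program is seen to accept and
    that has no colour yet; R consists of the elements of colour 1. Before step k at most
    k elements are coloured and only k numbers lie below k, which is what the
    count 2k compensates for. So if the search for (n, i) and s finds a
    witness below f(s), the corresponding step k >= s must give colour i to an element of
    F_n that is at least s ([good_within_budget]). But F decides R, hence some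
    column F_n has, from some point on, no elements of colour 1 (if F_n is
    almost included in the complement of R) or none of colour 0 (if it is
    almost included in R, as an element receives only one colour). For that
    (n, i) and all large s the witness therefore exceeds f(s), and
    f(s) < h(s).

    No totality question is ever asked of F, which is why h is total and is
    computed by a single program for all ultrafilter bases at once.

    The rest is about the model of computation: closure properties of the
    functions computed by programs, and a universal machine whose steps can be
    counted, [timed]. *)

(** * Pairing and bounded loops *)

Definition pr (x y : nat) : nat := to_nat (x, y).
Definition lft (n : nat) : nat := fst (of_nat n).
Definition rgt (n : nat) : nat := snd (of_nat n).

Lemma lft_pr x y : lft (pr x y) = x.
Proof. unfold lft, pr; now rewrite cancel_of_to. Qed.

Lemma rgt_pr x y : rgt (pr x y) = y.
Proof. unfold rgt, pr; now rewrite cancel_of_to. Qed.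

Lemma pr_lft_rgt n : pr (lft n) (rgt n) = n.
Proof. unfold lft, rgt, pr; now rewrite <- surjective_pairing, cancel_to_of. Qed.

Lemma pr_ge_l x y : x <= pr x y.
Proof. pose proof (to_nat_non_decreasing x y); unfold pr; lia. Qed.

Lemma pr_ge_r x y : y <= pr x y.
Proof. pose proof (to_nat_non_decreasing x y); unfold pr; lia. Qed.

Lemma lft_le n : lft n <= n.
Proof. rewrite <- (pr_lft_rgt n) at 2; apply pr_ge_l. Qed.

Lemma rgt_le n : rgt n <= n.
Proof. rewrite <- (pr_lft_rgt n) at 2; apply pr_ge_r. Qed.

(* The clauses of eval in terms of pr, lft and rgt, stated before these become
   opaque. *)
Lemma eval_Pair g a b x y : eval g (Pair a b) x y =
  exists u v, eval g a x u /\ eval g b x v /\ y = pr u v.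
Proof. reflexivity. Qed.

Lemma eval_Prec g a b x y : eval g (Prec a b) x y =
  exists w : nat -> nat, eval g a (lft x) (w 0) /\
    (forall i, i < rgt x -> eval g b (pr (lft x) (pr i (w i))) (w (S i))) /\
    y = w (rgt x).
Proof. reflexivity. Qed.

Lemma eval_Mu g a x y : eval g (Mu a) x y =
  (eval g a (pr x y) 0 /\
   forall m, m < y -> exists v, v <> 0 /\ eval g a (pr x m) v).
Proof. reflexivity. Qed.

#[global] Opaque pr lft rgt.

Definition loop (a : nat) (s : nat -> nat -> nat) (k : nat) : nat :=
  nat_rect (fun _ => nat) a s k.

Lemma loop_S a s k : loop a s (S k) = s k (loop a s k).
Proof. reflexivity. Qed.

(** The least hit is shifted by one, with 0 for none, so that a bounded
    quantifier becomes a test of this value against 0. *)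
Definition bsearch (p : nat -> bool) (b : nat) : nat :=
  loop 0 (fun i w => match w with 0 => if p i then S i else 0 | S _ => w end) b.

Definition count (p : nat -> bool) (b : nat) : nat :=
  loop 0 (fun i w => if p i then S w else w) b.

(** * Closure properties of programs *)

Section Closure.

Variables (orc : bool) (D : (nat -> nat) -> Prop).

Definition admissible (c : code) : Prop := if orc then True else oracle_free c.

(** One program computes F g for all oracles g in D, and it makes no queries when
    orc is false. The construction of a set from a computable f needs programs
    without queries, the dominating function needs the oracle; with these two
    parameters the closure properties are proved once for both. In
    [fun g n => ...] the number n stands for a whole environment, whose entries
    are reached by lft and rgt. *)
Definition rec (F : (nat -> nat) -> nat -> nat) : Prop :=
  exists c, admissible c /\ forall g, D g -> forall n, eval g c n (F g n).

Definition recb (P : (nat -> nat) -> nat -> bool) : Prop :=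
  rec (fun g n => if P g n then 1 else 0).

Lemma rec_ext F G : rec F -> (forall g n, F g n = G g n) -> rec G.
Proof. intros [c [Hc H]] E; exists c; split; trivial; intros; rewrite <- E; auto. Qed.

Lemma rec_pr F G : rec F -> rec G -> rec (fun g n => pr (F g n) (G g n)).
Proof.
intros [c [Hc H]] [c' [Hc' H']]; exists (Pair c c'); split.
- unfold admissible in *; destruct orc; simpl; auto.
- intros g Dg n; exists (F g n), (G g n); auto.
Qed.

Lemma rec_comp F G : rec F -> rec G -> rec (fun g n => F g (G g n)).
Proof.
intros [c [Hc H]] [c' [Hc' H']]; exists (Comp c c'); split.
- unfold admissible in *; destruct orc; simpl; auto.
- intros g Dg n; exists (G g n); auto.
Qed.

Lemma rec_lft F : rec F -> rec (fun g n => lft (F g n)).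
Proof.
intros H; apply (rec_comp (fun _ => lft) F); trivial.
exists Left; split; [now unfold admissible; destruct orc | reflexivity].
Qed.

Lemma rec_rgt F : rec F -> rec (fun g n => rgt (F g n)).
Proof.
intros H; apply (rec_comp (fun _ => rgt) F); trivial.
exists Right; split; [now unfold admissible; destruct orc | reflexivity].
Qed.

Lemma rec_S F : rec F -> rec (fun g n => S (F g n)).
Proof.
intros H; apply (rec_comp (fun _ => S) F); trivial.
exists Succ; split; [now unfold admissible; destruct orc | reflexivity].
Qed.

Lemma rec_O : rec (fun _ _ => 0).
Proof. exists Zero; split; [now unfold admissible; destruct orc | reflexivity]. Qed.

Lemma rec_id : rec (fun _ n => n).
Proof.
apply (rec_ext (fun _ n => pr (lft n) (rgt n))); [|intros; apply pr_lft_rgt].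
apply rec_pr.
- exists Left; split; [now unfold admissible; destruct orc | reflexivity].
- exists Right; split; [now unfold admissible; destruct orc | reflexivity].
Qed.

(** The environment p of the loop body packs the outer environment, the index
    and the accumulator, which is the format in which [Prec] calls its second
    program. *)
Lemma rec_loop A s K :
  rec A -> rec (fun g p => s g (lft p) (lft (rgt p)) (rgt (rgt p))) -> rec K ->
  rec (fun g n => loop (A g n) (s g n) (K g n)).
Proof.
intros [a [Ha HA]] [b [Hb HB]] HK.
apply (rec_ext (fun g n => (fun g p => loop (A g (lft p)) (s g (lft p)) (rgt p)) g
  (pr n (K g n)))); [|intros; now rewrite lft_pr, rgt_pr].
apply (rec_comp (fun g p => loop (A g (lft p)) (s g (lft p)) (rgt p))
  (fun g n => pr n (K g n))); [|now apply rec_pr; [apply rec_id|]].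
exists (Prec a b); split.
- unfold admissible in *; destruct orc; simpl; auto.
- intros g Dg p; exists (loop (A g (lft p)) (s g (lft p))).
  split; [now apply HA|split; [|reflexivity]].
  intros i _; pose proof (HB g Dg (pr (lft p) (pr i (loop (A g (lft p)) (s g (lft p)) i)))) as H.
  now rewrite !rgt_pr, !lft_pr in H.
Qed.

Lemma rec_case F A B : rec F -> rec A -> rec B ->
  rec (fun g n => match F g n with 0 => A g n | S _ => B g n end).
Proof.
intros HF HA HB.
apply (rec_ext (fun g n => loop (A g n) (fun _ _ => B g n) (F g n))).
- apply rec_loop; trivial.
  apply (rec_comp B (fun _ p => lft p)); trivial; apply rec_lft, rec_id.
- intros g n; now destruct (F g n).
Qed.

Lemma rec_if P A B : recb P -> rec A -> rec B ->
  rec (fun g n => if P g n then A g n else B g n).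
Proof.
intros HP HA HB.
apply (rec_ext (fun g n => match (if P g n then 1 else 0) with
  0 => B g n | S _ => A g n end)); [now apply rec_case|].
intros g n; now destruct (P g n).
Qed.

Lemma rec_pred F : rec F -> rec (fun g n => pred (F g n)).
Proof.
intros HF; apply (rec_ext (fun g n => loop 0 (fun i _ => i) (F g n))).
- apply rec_loop; trivial; [apply rec_O | apply rec_lft, rec_rgt, rec_id].
- intros g n; now destruct (F g n).
Qed.

Lemma rec_add F G : rec F -> rec G -> rec (fun g n => F g n + G g n).
Proof.
intros HF HG; apply (rec_ext (fun g n => loop (F g n) (fun _ w => S w) (G g n))).
- apply rec_loop; trivial; apply rec_S, rec_rgt, rec_rgt, rec_id.
- intros g n; induction (G g n) as [|k IH]; [simpl; lia|].
  rewrite loop_S, IH; lia.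
Qed.

Lemma rec_sub F G : rec F -> rec G -> rec (fun g n => F g n - G g n).
Proof.
intros HF HG; apply (rec_ext (fun g n => loop (F g n) (fun _ w => pred w) (G g n))).
- apply rec_loop; trivial; apply rec_pred, rec_rgt, rec_rgt, rec_id.
- intros g n; induction (G g n) as [|k IH]; [simpl; lia|].
  rewrite loop_S, IH; lia.
Qed.

Lemma recb_leb F G : rec F -> rec G -> recb (fun g n => F g n <=? G g n).
Proof.
intros HF HG; apply (rec_ext (fun g n => match F g n - G g n with 0 => 1 | S _ => 0 end)).
- apply rec_case; [now apply rec_sub | apply rec_S, rec_O | apply rec_O].
- intros g n; destruct (Nat.leb_spec (F g n) (G g n)) as [H|H].
  + now replace (F g n - G g n) with 0 by lia.
  + now replace (F g n - G g n) with (S (pred (F g n - G g n))) by lia.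
Qed.

Lemma recb_andb P Q : recb P -> recb Q -> recb (fun g n => P g n && Q g n).
Proof.
intros HP HQ; apply (rec_ext (fun g n => if P g n then if Q g n then 1 else 0 else 0)).
- apply rec_if; trivial; apply rec_O.
- intros g n; now destruct (P g n).
Qed.

Lemma recb_negb P : recb P -> recb (fun g n => negb (P g n)).
Proof.
intros HP; apply (rec_ext (fun g n => if P g n then 0 else 1)).
- apply rec_if; trivial; [apply rec_O | apply rec_S, rec_O].
- intros g n; now destruct (P g n).
Qed.

Lemma recb_eqb F G : rec F -> rec G -> recb (fun g n => F g n =? G g n).
Proof.
intros HF HG.
apply (rec_ext (fun g n => if (F g n <=? G g n) && (G g n <=? F g n) then 1 else 0)).
- now apply recb_andb; apply recb_leb.
- intros g n; destruct (Nat.eqb_spec (F g n) (G g n)) as [->|H].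
  + now rewrite Nat.leb_refl.
  + destruct (Nat.leb_spec (F g n) (G g n)), (Nat.leb_spec (G g n) (F g n)); simpl; lia.
Qed.

(** Discards the accumulator from the environment of a loop body. *)
Lemma recb_loop_index (P : (nat -> nat) -> nat -> nat -> bool) :
  recb (fun g q => P g (lft q) (rgt q)) ->
  recb (fun g p => P g (lft p) (lft (rgt p))).
Proof.
intros HP.
apply (rec_ext (fun g p => (fun g q => if P g (lft q) (rgt q) then 1 else 0) g
  (pr (lft p) (lft (rgt p))))); [|intros; now rewrite lft_pr, rgt_pr].
apply (rec_comp (fun g q => if P g (lft q) (rgt q) then 1 else 0)
  (fun _ p => pr (lft p) (lft (rgt p)))); [exact HP|].
apply rec_pr; [apply rec_lft, rec_id | apply rec_lft, rec_rgt, rec_id].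
Qed.

Lemma rec_bsearch (P : (nat -> nat) -> nat -> nat -> bool) K :
  recb (fun g q => P g (lft q) (rgt q)) -> rec K ->
  rec (fun g n => bsearch (P g n) (K g n)).
Proof.
intros HP HK; unfold bsearch.
apply (rec_loop (fun _ _ => 0) (fun g n i w =>
  match w with 0 => if P g n i then S i else 0 | S _ => w end)); trivial.
- apply rec_O.
- assert (W : rec (fun _ p => rgt (rgt p))) by apply rec_rgt, rec_rgt, rec_id.
  apply (rec_case _ (fun g p => if P g (lft p) (lft (rgt p)) then S (lft (rgt p)) else 0)); trivial.
  apply rec_if; [now apply recb_loop_index | apply rec_S, rec_lft, rec_rgt, rec_id | apply rec_O].
Qed.

Lemma rec_count (P : (nat -> nat) -> nat -> nat -> bool) K :
  recb (fun g q => P g (lft q) (rgt q)) -> rec K ->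
  rec (fun g n => count (P g n) (K g n)).
Proof.
intros HP HK; unfold count.
apply (rec_loop (fun _ _ => 0) (fun g n i w => if P g n i then S w else w)); trivial.
- apply rec_O.
- assert (W : rec (fun _ p => rgt (rgt p))) by apply rec_rgt, rec_rgt, rec_id.
  apply rec_if; [now apply recb_loop_index | now apply rec_S | exact W].
Qed.

(** Unbounded search is total on D as soon as every oracle in D has witnesses for
    all inputs; [Mu] finds the least one. *)
Lemma rec_mu (P : (nat -> nat) -> nat -> nat -> bool) :
  recb (fun g q => P g (lft q) (rgt q)) ->
  (forall g, D g -> forall n, exists v, P g n v = true) ->
  exists V, rec V /\ forall g, D g -> forall n, P g n (V g n) = true.
Proof.
intros HP Hex.
assert (Hmin : forall g n, exists v, D g -> P g n v = true /\
  forall m, m < v -> P g n m = false).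
{ intros g n; destruct (classic (D g)) as [Dg|]; [|now exists 0].
  destruct (Hex g Dg n) as [v0 H0].
  induction v0 as [v IH] using lt_wf_ind.
  destruct (classic (exists m, m < v /\ P g n m = true)) as [[m [Hm E]]|N]; [eauto|].
  exists v; intros _; split; trivial.
  intros m Hm; destruct (P g n m) eqn:E; trivial; exfalso; eauto. }
destruct (recb_negb _ HP) as [c [Hc H]].
exists (fun g n => proj1_sig (constructive_indefinite_description _ (Hmin g n))).
split.
- exists (Mu c); split; [unfold admissible in *; destruct orc; auto|].
  intros g Dg n; destruct (constructive_indefinite_description _ (Hmin g n)) as [v Hv].
  destruct (Hv Dg) as [Hv1 Hv2]; simpl; split.
  + pose proof (H g Dg (pr n v)) as E; cbv beta in E.
    now rewrite lft_pr, rgt_pr, Hv1 in E.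
  + intros m Hm; exists 1; split; [discriminate|].
    pose proof (H g Dg (pr n m)) as E; cbv beta in E.
    now rewrite lft_pr, rgt_pr, (Hv2 m Hm) in E.
- intros g Dg n; destruct (constructive_indefinite_description _ (Hmin g n)) as [v Hv].
  now apply Hv.
Qed.

End Closure.

Create HintDb rec.
#[global] Hint Resolve rec_pr rec_lft rec_rgt rec_S rec_O rec_id rec_loop rec_case
  rec_if rec_pred rec_add rec_sub recb_leb recb_andb recb_negb recb_eqb rec_bsearch
  rec_count : rec.
#[global] Hint Opaque rec recb : rec.

(** * A universal machine *)

(* A state is pr stack value. A stack is 0 or pr instruction stack' plus 1, so
   that 0 is the empty stack. *)
Definition push (ins stack : nat) : nat := S (pr ins stack).

(** A program is itself an instruction, to be run on the current value. *)
Fixpoint enc (c : code) : nat :=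
  match c with
  | Zero => pr 0 0
  | Succ => pr 1 0
  | Left => pr 2 0
  | Right => pr 3 0
  | Oracle => 0
  | Pair a b => pr 4 (pr (enc a) (enc b))
  | Comp a b => pr 5 (pr (enc a) (enc b))
  | Prec a b => pr 6 (pr (enc a) (enc b))
  | Mu a => pr 7 (enc a)
  end.

(** Tags 0 to 7 are the program constructors. The other instructions are
    continuations that carry saved data: 8 and 9 run the second half of a pair
    and assemble it, 10 is a primitive recursion with its parameter, its
    counter and the number of rounds left, and 11 is an unbounded search that
    inspects the value for its current candidate. *)
Definition exec (tag q k v : nat) : nat :=
  let a := lft q in
  let b := rgt q in
  if tag =? 0 then pr k 0
  else if tag =? 1 then pr k (S v)
  else if tag =? 2 then pr k (lft v)
  else if tag =? 3 then pr k (rgt v)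
  else if tag =? 4 then pr (push a (push (pr 8 (pr b v)) k)) v
  else if tag =? 5 then pr (push b (push a k)) v
  else if tag =? 6 then
    pr (push a (push (pr 10 (pr b (pr (lft v) (pr 0 (rgt v))))) k)) (lft v)
  else if tag =? 7 then pr (push q (push (pr 11 (pr q (pr v 0))) k)) (pr v 0)
  else if tag =? 8 then pr (push a (push (pr 9 v) k)) b
  else if tag =? 9 then pr k (pr q v)
  else if tag =? 10 then
    let z := lft b in
    let i := lft (rgt b) in
    match rgt (rgt b) with
    | 0 => pr k v
    | S _ => pr (push a (push (pr 10 (pr a (pr z (pr (S i) (pred (rgt (rgt b))))))) k))
                (pr z (pr i v))
    end
  else
    match v with
    | 0 => pr k (rgt b)
    | S _ => pr (push a (push (pr 11 (pr a (pr (lft b) (S (rgt b))))) k))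
                (pr (lft b) (S (rgt b)))
    end.

Definition step (st : nat) : nat :=
  match lft st with
  | 0 => st
  | S _ => let p := pred (lft st) in
           exec (lft (lft p)) (rgt (lft p)) (rgt p) (rgt st)
  end.

Definition run (st t : nat) : nat := loop st (fun _ => step) t.

(** Outputs are shifted by one, since 0 stands for a machine still running. *)
Definition timed (d x t : nat) : nat :=
  match lft (run (pr (push d 0) x) t) with
  | 0 => S (rgt (run (pr (push d 0) x) t))
  | S _ => 0
  end.

Lemma rec_step orc D F : rec orc D F -> rec orc D (fun g n => step (F g n)).
Proof. intros H; unfold step, exec, push; auto 100 with rec. Qed.
#[global] Hint Resolve rec_step : rec.

Lemma rec_timed orc D A B C : rec orc D A -> rec orc D B -> rec orc D C ->
  rec orc D (fun g n => timed (A g n) (B g n) (C g n)).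
Proof. intros; unfold timed, run, push; auto 100 with rec. Qed.
#[global] Hint Resolve rec_timed : rec.

Definition reach (s s' : nat) : Prop := exists t, run s t = s'.

Lemma run_add s t u : run s (t + u) = run (run s t) u.
Proof.
induction u as [|u IH]; [now rewrite Nat.add_0_r|].
rewrite Nat.add_succ_r; unfold run in *; now rewrite !loop_S, IH.
Qed.

Lemma reach_refl s : reach s s.
Proof. now exists 0. Qed.

Lemma reach_trans s s' s'' : reach s s' -> reach s' s'' -> reach s s''.
Proof. intros [t <-] [u <-]; exists (t + u); apply run_add. Qed.

Lemma reach_exec tag q k v s :
  reach (exec tag q k v) s -> reach (pr (push (pr tag q) k) v) s.
Proof.
apply reach_trans; exists 1; unfold run; rewrite loop_S; simpl.
unfold step, push; rewrite lft_pr; simpl; now rewrite !lft_pr, !rgt_pr, ?lft_pr, ?rgt_pr.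
Qed.

Ltac machine := apply reach_exec; unfold exec; simpl;
  repeat first [rewrite lft_pr | rewrite rgt_pr].

(** The stack k is arbitrary because the induction runs subprograms on top of
    pending continuations. *)
Lemma reach_eval g c : oracle_free c ->
  forall x y k, eval g c x y -> reach (pr (push (enc c) k) x) (pr k y).
Proof.
induction c as [ | | | | | a IHa b IHb | a IHa b IHb | a IHa b IHb | a IHa];
  intros Hc x y k; rewrite ?eval_Pair, ?eval_Prec, ?eval_Mu; simpl in Hc |- *.
- intros ->; machine; apply reach_refl.
- intros ->; machine; apply reach_refl.
- intros ->; machine; apply reach_refl.
- intros ->; machine; apply reach_refl.
- destruct Hc.
- destruct Hc as [Ca Cb]; intros (u & v & Hu & Hv & ->).
  machine; eapply reach_trans; [now apply IHa, Hu|].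
  machine; eapply reach_trans; [now apply IHb, Hv|].
  machine; apply reach_refl.
- destruct Hc as [Ca Cb]; intros (u & Hu & Hy).
  machine; eapply reach_trans; [now apply IHb, Hu|].
  now apply IHa.
- destruct Hc as [Ca Cb]; intros (w & H0 & HS & ->).
  machine; eapply reach_trans; [now apply IHa, H0|].
  set (z := lft x) in *; set (n := rgt x) in *.
  assert (L : forall m i, i + m = n ->
    reach (pr (push (pr 10 (pr (enc b) (pr z (pr i m)))) k) (w i)) (pr k (w n))).
  { induction m as [|m IHm]; intros i E.
    - machine; replace n with i by lia; apply reach_refl.
    - machine; eapply reach_trans; [apply IHb; [exact Cb|apply HS; lia]|].
      apply IHm; lia. }
  now apply L.
- intros [Hy Hlt]; machine.
  assert (L : forall j m, m + j = y ->
    reach (pr (push (enc a) (push (pr 11 (pr (enc a) (pr x m))) k)) (pr x m)) (pr k y)).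
  { induction j as [|j IHj]; intros m E.
    - replace m with y by lia.
      eapply reach_trans; [apply IHa; [exact Hc|exact Hy]|].
      machine; apply reach_refl.
    - destruct (Hlt m) as (v & Hv & Ev); [lia|].
      eapply reach_trans; [apply IHa; [exact Hc|exact Ev]|].
      destruct v as [|v]; [easy|].
      machine; apply IHj; lia. }
  now apply (L y).
Qed.

Lemma timed_complete g c x y : oracle_free c -> eval g c x y ->
  exists t, timed (enc c) x t = S y.
Proof.
intros Hc H; destruct (reach_eval g c Hc x y 0 H) as [t E].
exists t; unfold timed; now rewrite E, lft_pr, rgt_pr.
Qed.

(** A state with empty stack is a fixed point of the step function. *)
Lemma timed_mono d x y t t' : timed d x t = S y -> t <= t' -> timed d x t' = S y.
Proof.
intros H L; unfold timed in *; replace t' with (t + (t' - t)) by lia; rewrite run_add.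
revert H; generalize (run (pr (push d 0) x) t); intros s H.
replace (run s (t' - t)) with s; trivial; symmetry.
induction (t' - t) as [|u IH]; trivial.
unfold run in *; rewrite loop_S, IH; unfold step; now destruct (lft s).
Qed.

(** * Counting and finite sets *)

Lemma bsearch_some p b x : bsearch p b = S x ->
  x < b /\ p x = true /\ forall y, y < x -> p y = false.
Proof.
enough (G : match bsearch p b with
  | 0 => forall y, y < b -> p y = false
  | S z => z < b /\ p z = true /\ forall y, y < z -> p y = false end)
  by (intros E; now rewrite E in G).
induction b as [|b IH]; [simpl; lia|].
unfold bsearch in *; rewrite loop_S.
destruct (loop _ _ b) as [|z].
- destruct (p b) eqn:E; [repeat split; auto|].
  intros y Hy; destruct (Nat.eq_dec y b) as [->|]; trivial; apply IH; lia.
- destruct IH as (? & ? & ?); repeat split; trivial; lia.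
Qed.

Lemma bsearch_none p b : bsearch p b = 0 <-> forall y, y < b -> p y = false.
Proof.
induction b as [|b IH]; [split; [lia|reflexivity]|].
unfold bsearch in *; rewrite loop_S.
destruct (loop _ _ b) as [|z].
- destruct (p b) eqn:E.
  + split; [discriminate|]; intros H; rewrite H in E; [discriminate|lia].
  + split; trivial; intros _ y Hy.
    destruct (Nat.eq_dec y b) as [->|]; trivial; apply IH; trivial; lia.
- split; [discriminate|]; intros H; apply IH; intros; apply H; lia.
Qed.

Lemma count_filter p b : count p b = length (filter p (seq 0 b)).
Proof.
induction b as [|b IH]; trivial.
unfold count in *; rewrite loop_S, seq_S, filter_app, length_app, IH; simpl.
destruct (p b); simpl; lia.
Qed.

Lemma count_pigeonhole p b L : length L < count p b ->
  exists x, x < b /\ p x = true /\ ~ List.In x L.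
Proof.
intros H; rewrite count_filter in H.
apply NNPP; intros N; apply (Nat.lt_irrefl (length L)).
eapply Nat.lt_le_trans; [exact H|].
apply NoDup_incl_length; [apply NoDup_filter, seq_NoDup|].
intros x Hx; apply filter_In in Hx as [Hx Px]; apply in_seq in Hx.
apply NNPP; intros Nx; apply N; exists x; repeat split; trivial; lia.
Qed.

Lemma count_unbounded p : (forall N, exists x, N <= x /\ p x = true) ->
  forall K, exists b, K < count p b.
Proof.
intros H K; induction K as [|K [b IH]].
- destruct (H 0) as (x & _ & Px); exists (S x).
  unfold count; rewrite loop_S, Px; lia.
- destruct (H b) as (x & Hx & Px); exists (S x).
  assert (M : forall b', b <= b' -> K < count p b').
  { induction 1 as [|b' _ IH']; trivial.
    unfold count in *; rewrite loop_S; destruct (p b'); lia. }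
  specialize (M x Hx); unfold count in *; rewrite loop_S, Px; lia.
Qed.

Lemma Finite_bounded A : Finite nat A -> exists N, forall x, In nat A x -> x < N.
Proof.
induction 1 as [|A _ [N IH] x _].
- exists 0; intros x [].
- exists (N + S x); intros y [z Hz|z Hz]; [apply IH in Hz|destruct Hz]; lia.
Qed.

Lemma bounded_Finite A N : (forall x, In nat A x -> x < N) -> Finite nat A.
Proof.
intros H; apply Finite_downward_closed with (A := fun x => x < N); [|exact H].
clear; induction N as [|N IH].
- replace (fun x => x < 0) with (Empty_set nat); [constructor|].
  apply Extensionality_Ensembles; split; [intros x [] | intros x Hx; unfold In in Hx; lia].
- replace (fun x => x < S N) with (Add nat (fun x => x < N) N).
  + constructor; trivial; unfold In; lia.
  + apply Extensionality_Ensembles; split; intros x Hx.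
    * destruct Hx as [x Hx|x []]; unfold In in *; lia.
    * unfold In in Hx; destruct (Nat.eq_dec x N) as [->|]; [right; constructor|left; unfold In; lia].
Qed.

(** * The dominating function *)

(** A number k = pr a (pr d i) carries the program d and the colour i; the
    padding a makes every pair (d, i) occur at arbitrarily large k. *)
Definition prog (k : nat) : nat := lft (rgt k).
Definition color (k : nat) : nat := rgt (rgt k).

(** The number v = pr k (pr b t) witnesses that F_n, n = lft m, looks simple at
    s for the colour rgt m: the program of k >= s computes F_n on all x < b
    within t steps, and more than 2k of these x belong to F_n. Here g is the
    characteristic function of F. *)
Definition good (g : nat -> nat) (m s v : nat) : bool :=
  let k := lft v in
  let b := lft (rgt v) in
  let t := rgt (rgt v) in
  (s <=? k) && (color k =? rgt m) &&
  (bsearch (fun x => negb (timed (prog k) x t =? S (g (pr x (lft m))))) b =? 0) &&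
  (S (k + k) <=? count (fun x => g (pr x (lft m)) =? 1) b).

Lemma chi_1 X x : chi X x = 1 <-> In nat X x.
Proof. unfold chi; destruct excluded_middle_informative; split; easy. Qed.

Lemma ultrafilter_column_unbounded F n : ultrafilter_base F ->
  forall N, exists x, N <= x /\ In nat (column F n) x.
Proof.
intros (_ & _ & H & _) N; destruct (H n) as [_ H'].
apply NNPP; intros E; apply H'; apply bounded_Finite with N.
intros x [Hx _]; apply NNPP; intros L; apply E; exists x; split; trivial; lia.
Qed.

(** A true program for the column, placed at a large k, is a witness once b and
    t are large enough. *)
Lemma good_exists F : ultrafilter_base F ->
  forall m s, exists v, good (chi F) m s v = true.
Proof.
intros HF m s; set (n := lft m).
destruct (proj1 HF n) as [c [Hc Ec]].
assert (Hp : forall N, exists x, N <= x /\ (chi F (pr x n) =? 1) = true).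
{ intros N; destruct (ultrafilter_column_unbounded F n HF N) as (x & Hx & H).
  exists x; split; trivial; apply Nat.eqb_eq, chi_1; exact H. }
set (k := pr s (pr (enc c) (rgt m))).
destruct (count_unbounded _ Hp (k + k)) as [b Hb].
assert (Ht : exists t, forall x, x < b -> timed (enc c) x t = S (chi F (pr x n))).
{ clear Hb; induction b as [|b [t IH]]; [exists 0; lia|].
  destruct (timed_complete _ c b _ Hc (Ec b)) as [t' Ht'].
  exists (t + t'); intros x Hx; destruct (Nat.eq_dec x b) as [->|].
  - apply timed_mono with t'; [exact Ht'|lia].
  - apply timed_mono with t; [apply IH|]; lia. }
destruct Ht as [t Ht]; exists (pr k (pr b t)).
unfold good, prog, color; rewrite !lft_pr, !rgt_pr, !lft_pr; unfold k at 1 2 3.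
rewrite !rgt_pr, !lft_pr; rewrite !andb_true_iff; repeat split.
- apply Nat.leb_le, pr_ge_l.
- apply Nat.eqb_refl.
- apply Nat.eqb_eq, bsearch_none; intros x Hx; apply negb_false_iff, Nat.eqb_eq; auto.
- apply Nat.leb_le, Hb.
Qed.

Lemma rec_oracle D F : rec true D F -> rec true D (fun g n => g (F g n)).
Proof.
intros H; apply (rec_comp true D (fun g => g) F); trivial.
exists Oracle; split; [exact I | reflexivity].
Qed.
#[global] Hint Resolve rec_oracle : rec.

Lemma recb_good D :
  recb true D (fun g q => good g (lft (lft q)) (rgt (lft q)) (rgt q)).
Proof. unfold good, prog, color; auto 100 with rec. Qed.

(** Summing the witnesses for all m <= s, and s itself, bounds each of them. *)
Lemma exists_bound : exists h, rec true U h /\ forall F, ultrafilter_base F ->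
  forall s, s <= h (chi F) s /\
    forall m, m <= s -> exists v, v <= h (chi F) s /\ good (chi F) m s v = true.
Proof.
destruct (rec_mu true U (fun g q v => good g (lft q) (rgt q) v)) as [V [HV GV]].
{ apply recb_good. }
{ intros g [F HF g' ->] q; now apply good_exists. }
exists (fun g s => s + loop 0 (fun m w => w + V g (pr m s)) (S s)); split.
{ apply rec_add; auto with rec.
  apply (rec_loop true U (fun _ _ => 0) (fun g s m w => w + V g (pr m s))); auto with rec.
  apply rec_add; auto with rec.
  apply (rec_comp true U V (fun g p => pr (lft (rgt p)) (lft p))); auto with rec. }
intros F HF s; split; [lia|].
intros m Hm; exists (V (chi F) (pr m s)); split.
- enough (G : forall j, m < j -> V (chi F) (pr m s) <=
    loop 0 (fun m w => w + V (chi F) (pr m s)) j) by (specialize (G (S s)); lia).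
  induction j as [|j IH]; [lia|]; intros Hj; rewrite loop_S.
  destruct (Nat.eq_dec m j) as [->|]; [lia|]; specialize (IH ltac:(lia)); lia.
- assert (UF : U (chi F)) by (now exists F).
  pose proof (GV _ UF (pr m s)) as G; now rewrite lft_pr, rgt_pr in G.
Qed.

(** * A computable coloring that splits simple columns *)

Section Diagonal.

Variable f : nat -> nat.

Definition budget (k : nat) : nat := loop 0 (fun j w => w + f j) (S k).

Lemma le_budget s k : s <= k -> f s <= budget k.
Proof.
unfold budget; intros H; rewrite loop_S.
destruct (Nat.eq_dec s k) as [->|]; [lia|].
enough (G : forall j, s < j -> f s <= loop 0 (fun j w => w + f j) j)
  by (specialize (G k ltac:(lia)); lia).
induction j as [|j IH]; [lia|]; intros Hj; rewrite loop_S.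
destruct (Nat.eq_dec s j) as [->|]; [lia|]; specialize (IH ltac:(lia)); lia.
Qed.

(** A history of k steps is a nested pair with the latest step outermost; its
    entry i is the step k - 1 - i. *)
Definition entry (H i : nat) : nat := lft (loop H (fun _ => rgt) i).

Definition used (k H x : nat) : bool :=
  negb (bsearch (fun i => entry H i =? S x) k =? 0).

Definition choose (k H : nat) : nat :=
  bsearch (fun x => (k <=? x) && negb (used k H x) &&
                    (timed (prog k) x (budget k) =? 2)) (S (budget k)).

Definition history (k : nat) : nat := loop 0 (fun j H => pr (choose j H) H) k.

Definition pick (k : nat) : nat := choose k (history k).

Definition split_set (x : nat) : Prop :=
  exists k, color k = 1 /\ pick k = S x.

Lemma entry_history k i : i < k -> entry (history k) i = pick (k - S i).
Proof.
intros H; unfold entry; replace (loop (history k) (fun _ => rgt) i) with (history (k - i)).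
- replace (k - i) with (S (k - S i)) by lia.
  unfold history at 1; rewrite loop_S; apply lft_pr.
- induction i as [|i IH]; [simpl; f_equal; lia|].
  rewrite loop_S, <- IH by lia.
  replace (k - i) with (S (k - S i)) by lia.
  unfold history at 2; rewrite loop_S; symmetry; apply rgt_pr.
Qed.

Lemma used_spec k x :
  used k (history k) x = true <-> exists j, j < k /\ pick j = S x.
Proof.
unfold used; rewrite negb_true_iff, Nat.eqb_neq; split.
- intros N; destruct (bsearch _ k) as [|i] eqn:E; [easy|].
  apply bsearch_some in E as (Hi & E & _); apply Nat.eqb_eq in E.
  rewrite entry_history in E by trivial; exists (k - S i); split; trivial; lia.
- intros (j & Hj & E) B; pose proof (proj1 (bsearch_none _ _) B (k - S j) ltac:(lia)) as N.
  apply Nat.eqb_neq in N; apply N.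
  rewrite entry_history by lia; now replace (k - S (k - S j)) with j by lia.
Qed.

Lemma pick_some k x : pick k = S x ->
  k <= x /\ (forall j, j < k -> pick j <> S x) /\ timed (prog k) x (budget k) = 2.
Proof.
intros E; apply bsearch_some in E as (_ & E & _).
apply andb_true_iff in E as [E ET]; apply andb_true_iff in E as [EL EU].
apply Nat.leb_le in EL; apply Nat.eqb_eq in ET.
repeat split; trivial; intros j Hj Ej.
assert (Hu : used k (history k) x = true) by (apply used_spec; eauto).
now rewrite Hu in EU.
Qed.

(** An element is coloured at most once, so it has only one colour. *)
Lemma pick_inj j k x : pick j = S x -> pick k = S x -> j = k.
Proof.
intros Ej Ek; destruct (Nat.lt_trichotomy j k) as [L|[L|L]]; trivial; exfalso.
- apply pick_some in Ek as (_ & N & _); exact (N j L Ej).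
- apply pick_some in Ej as (_ & N & _); exact (N k L Ek).
Qed.

(** Among more than 2k elements found by the program, one is neither below k nor
    already coloured. The element picked is the least such, hence also lies
    below b, where the program is known to be correct. *)
Lemma pick_exists k b p t :
  k + k < count p b -> b <= budget k -> t <= budget k ->
  (forall x, x < b -> timed (prog k) x t = if p x then 2 else 1) ->
  exists y, pick k = S y /\ p y = true.
Proof.
intros Hc Hb Ht HT.
destruct (count_pigeonhole p b (seq 0 k ++ map (fun j => pred (pick j)) (seq 0 k)))
  as (x & Hx & Px & Nx).
{ rewrite length_app, length_map, length_seq; lia. }
assert (HT' : forall z, z < b -> timed (prog k) z (budget k) = if p z then 2 else 1).
{ intros z Hz; specialize (HT z Hz).
  destruct (p z); apply timed_mono with t; trivial. }
assert (C : (k <=? x) && negb (used k (history k) x) &&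
            (timed (prog k) x (budget k) =? 2) = true).
{ rewrite !andb_true_iff; repeat split.
  - apply Nat.leb_le, Nat.nlt_ge; intros L; apply Nx, in_or_app; left; apply in_seq; lia.
  - apply negb_true_iff, not_true_iff_false; intros Hu; apply used_spec in Hu as (j & Hj & E).
    apply Nx, in_or_app; right; apply in_map_iff; exists j; split; [now rewrite E|].
    apply in_seq; lia.
  - now rewrite HT', Px by trivial. }
destruct (pick k) as [|y] eqn:E.
- unfold pick, choose in E.
  pose proof (proj1 (bsearch_none _ _) E x ltac:(lia)) as N; cbv beta in N; congruence.
- exists y; split; trivial.
  pose proof E as E'; apply bsearch_some in E' as (_ & _ & Lst).
  assert (Hy : y <= x).
  { apply Nat.nlt_ge; intros L; specialize (Lst x L); cbv beta in Lst; congruence. }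
  apply pick_some in E as (_ & _ & E); rewrite HT' in E by lia.
  now destruct (p y).
Qed.

(** An element x can only be coloured at a step k <= x, so membership is a
    bounded search through the picks. *)
Lemma computable_split_set : computable f -> computable_set split_set.
Proof.
intros [cf [Hcf Ef]].
set (D := fun g : nat -> nat => g = fun _ => 0).
assert (Hf : rec false D (fun _ => f)).
{ exists cf; split; trivial; intros g ->; exact Ef. }
assert (lift : forall F, rec false D (fun _ => F) ->
  forall X, rec false D X -> rec false D (fun g n => F (X g n)))
  by (intros F HF X; now apply rec_comp).
pose proof (lift _ Hf) as Hf'.
assert (Hh : rec false D (fun _ => history)).
{ unfold history, choose, used, entry, budget, prog; auto 100 with rec. }
pose proof (lift _ Hh) as Hh'.
assert (Hp : rec false D (fun _ => pick)).
{ unfold pick, choose, used, entry, budget, prog; auto 100 with rec. }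
pose proof (lift _ Hp) as Hp'.
assert (HR : rec false D (fun _ x =>
  if bsearch (fun k => (color k =? 1) && (pick k =? S x)) (S x) =? 0 then 0 else 1)).
{ unfold color; auto 100 with rec. }
destruct HR as [c [Hc Ec]]; exists c; split; [exact Hc|].
intros x; specialize (Ec _ eq_refl x).
replace (chi split_set x) with
  (if bsearch (fun k => (color k =? 1) && (pick k =? S x)) (S x) =? 0 then 0 else 1); trivial.
clear; destruct (Nat.eqb_spec (bsearch (fun k => (color k =? 1) && (pick k =? S x)) (S x)) 0)
  as [E|N]; unfold chi; destruct excluded_middle_informative as [R|R]; trivial; exfalso.
- destruct R as (k & Ck & Pk).
  assert (k <= x) by now apply pick_some in Pk.
  pose proof (proj1 (bsearch_none _ _) E k ltac:(lia)) as B; cbv beta in B.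
  now rewrite Ck, Pk, !Nat.eqb_refl in B.
- destruct (bsearch _ (S x)) as [|k] eqn:E; [easy|]; apply R; exists k.
  apply bsearch_some in E as (_ & E & _); apply andb_true_iff in E as [E1 E2].
  split; now apply Nat.eqb_eq.
Qed.

(** The budget of step k >= s is at least f s, hence covers the witness. *)
Lemma good_within_budget F m s v : good (chi F) m s v = true -> v <= f s ->
  exists k y, s <= y /\ color k = rgt m /\ pick k = S y /\ In nat (column F (lft m)) y.
Proof.
unfold good; rewrite !andb_true_iff; intros [[[H1 H2] H3] H4] Hv.
apply Nat.leb_le in H1, H4; apply Nat.eqb_eq in H2, H3.
set (k := lft v) in *; set (b := lft (rgt v)) in *; set (t := rgt (rgt v)) in *.
pose proof (le_budget s k H1).
assert (b <= v) by (eapply Nat.le_trans; [apply lft_le | apply rgt_le]).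
assert (t <= v) by (eapply Nat.le_trans; [apply rgt_le | apply rgt_le]).
destruct (pick_exists k b (fun x => chi F (pr x (lft m)) =? 1) t) as (y & Py & Iy);
  try lia.
{ intros x Hx; pose proof (proj1 (bsearch_none _ _) H3 x Hx) as E; cbv beta in E.
  apply negb_false_iff, Nat.eqb_eq in E; rewrite E; unfold chi.
  now destruct excluded_middle_informative. }
apply Nat.eqb_eq in Iy; apply (proj1 (chi_1 _ _)) in Iy; exists k, y; repeat split; trivial.
apply pick_some in Py as [L _]; lia.
Qed.

End Diagonal.

Theorem theorem3p6 : medvedev_le DomFcn U.
Proof.
destruct exists_bound as [h [[c [_ Hc]] Hh]].
exists c; intros g Ug; exists (h g); split; [|now apply Hc].
destruct Ug as [F HF g ->]; specialize (Hh F HF); split; [|apply Hh].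
intros f Hf.
destruct HF as (_ & _ & _ & HR).
destruct (HR _ (computable_split_set f Hf)) as [n Hn].
(* i is the colour that the column n avoids from N on *)
assert (Hi : exists i N, forall k y, N <= y -> color k = i -> pick f k = S y ->
  ~ In nat (column F n) y).
{ destruct Hn as [Hn|Hn]; apply Finite_bounded in Hn as [N HN].
  - exists 0, N; intros k y Hy Ck Pk Iy.
    enough (In nat (split_set f) y) as (k' & Ck' & Pk').
    { rewrite (pick_inj f k k' y Pk Pk') in Ck; congruence. }
    apply NNPP; intros Ny; specialize (HN y (conj Iy Ny)); lia.
  - exists 1, N; intros k y Hy Ck Pk Iy.
    enough (y < N) by lia.
    apply HN; split; trivial; intros Ny; apply Ny; now exists k. }
destruct Hi as (i & N & Hi).
exists (N + pr n i); intros s Hs.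
destruct (proj2 (Hh s) (pr n i)) as (v & Hv & Gv); [lia|].
destruct (Nat.le_gt_cases v (f s)) as [L|L]; [exfalso|lia].
destruct (good_within_budget f F _ s v Gv L) as (k & y & Hy & Ck & Pk & Iy).
rewrite lft_pr in Iy; rewrite rgt_pr in Ck.
apply (Hi k y); trivial; lia.
Qed.
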